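(* Let $\Gamma$ be an abstract group, let $F$ be a field of characteristic zero, and let $\rho_1,\rho_2:\Gamma\to GL_n(F)$ be semisimple representations. Then the following are equivalent: (1) $\rho_1$ and $\rho_2$ are potentially equivalent; (2) there is a natural number $m\geq 1$ such that $\chi^{[m]}_{\rho_1}=\chi^{[m]}_{\rho_2}$, i.e. $\mathrm{Tr}(\rho_1(g^m))=\mathrm{Tr}(\rho_2(g^m))$ for all $g\in\Gamma$.
   Context: Two representations of a group are potentially equivalent if their restrictions to some subgroup of finite index are isomorphic. For a representation $\rho:\Gamma\to GL_n(F)$ and a natural number $m$, the $m$-power character of $\rho$ is the function $\chi^{[m]}_\rho:\Gamma\to F$, $g\mapsto \mathrm{Tr}(\rho(g^m))$. *)

(* Defs.v *)
From HB Require Import structures.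
From mathcomp Require Import all_boot all_order all_algebra.

Set Implicit Arguments.
Unset Strict Implicit.
Unset Printing Implicit Defensive.

Import GRing.Theory.
Local Open Scope ring_scope.

(* A representation Gamma -> GL_n(F). Matrices act on column vectors on the
   left. *)
Record mxrep (Gamma : groupType) (F : fieldType) (n : nat) := MxRep {
  mxrep_fun :> Gamma -> 'M[F]_n;
  mxrep_unit : forall g, mxrep_fun g \in unitmx;
  mxrep1 : mxrep_fun 1%g = 1%:M;
  mxrepM : forall g h, mxrep_fun (g * h)%g = mxrep_fun g *m mxrep_fun h }.

Section Representations.

Variables (Gamma : groupType) (F : fieldType) (n : nat).
Implicit Types (rho : mxrep Gamma F n) (U W : {vspace 'cV[F]_n}).
Implicit Type H : Gamma -> Prop.

Definition subrep rho U : Prop :=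
  forall (g : Gamma) (v : 'cV[F]_n), v \in U -> rho g *m v \in U.

Definition irreducible_subrep rho U : Prop :=
  [/\ subrep rho U, U != 0%VS
    & forall W, subrep rho W -> (W <= U)%VS -> W = 0%VS \/ W = U].

Definition semisimple rho : Prop :=
  exists (k : nat) (V : 'I_k -> {vspace 'cV[F]_n}),
    [/\ forall i, irreducible_subrep rho (V i),
        (\sum_(i < k) V i)%VS = fullv
      & directv (\sum_(i < k) V i)].

Definition subgroup H : Prop :=
  [/\ H 1%g, forall g h, H g -> H h -> H (g * h)%g
    & forall g, H g -> H (g^-1)%g].

(* Gamma is covered by the finitely many left cosets x H, x in s. *)
Definition finite_index H : Prop :=
  exists s : seq Gamma, forall g, exists2 x, x \in s & H (x^-1 * g)%g.

Definition isomorphic_on H rho1 rho2 : Prop :=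
  exists2 P : 'M[F]_n, P \in unitmx
    & forall h, H h -> P *m rho1 h = rho2 h *m P.

Definition potentially_equivalent rho1 rho2 : Prop :=
  exists H, [/\ subgroup H, finite_index H & isomorphic_on H rho1 rho2].

Definition power_character (m : nat) rho (g : Gamma) : F := \tr (rho (g ^+ m)%g).

End Representations.

(* Main.v *)
(**
  If [rho1] and [rho2] agree on a subgroup of index [k], then [g ^+ k`!] always
  lies in that subgroup, so the [k`!]-power characters agree.

  Conversely, suppose that the [m]-power characters agree.  Let [chi] be the
  product of the characteristic polynomials of [rho1 g] and [rho2 g], of degree
  [N], and let [h g] be the determinant of the residues of [1, X^m, ...,
  X^(m(N-1))] modulo [chi].  If [h g <> 0] then [X] is congruent modulo [chi] to
  a polynomial in [X^m], so by Cayley-Hamilton the traces of [rho1 g] and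
  [rho2 g] are the same combination of the traces of the powers of [g ^+ m],
  and they are equal.  Thus the function [f g := tr (rho1 g) - tr (rho2 g)]
  satisfies [f * h = 0], while [h 1 <> 0] because [X^m - 1] has a simple root at
  [1] in characteristic zero.  As [f] and [h] are matrix coefficients of a single
  finite-dimensional representation, they define closed sets for a Noetherian
  topology on [Gamma] invariant under translations; an irreducible component
  through [1] lies in the zero set of [f], and its stabiliser is a subgroup of
  finite index on which [f] vanishes.

  Restricted to the normal core of this subgroup, both representations remain
  semisimple by Clifford's argument, and they have equal traces.  To conclude,
  take an intertwiner of maximal rank: there are no nonzero intertwiners between
  the leftover summands in either direction, so the projection to the first of
  them lies in the span of the group and has trace zero, hence vanishes.
*)

Require Import Defs.
From mathcomp Require Import all_boot all_order all_algebra.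
From mathcomp Require Import boolp mxtens.

Set Implicit Arguments.
Unset Strict Implicit.
Unset Printing Implicit Defensive.

Import GRing.Theory.
Local Open Scope ring_scope.

(** * Subgroups of finite index *)

Section FiniteIndex.

Variable Gamma : groupType.
Implicit Types H : Gamma -> Prop.

Lemma subgroupX H g k : subgroup H -> H g -> H (g ^+ k)%g.
Proof.
move=> [H1 HM _] Hg; elim: k => [|k IHk]; first by rewrite expg0.
by rewrite expgS; apply: HM.
Qed.

(** Pigeonhole: two of the powers [g ^+ i] with [i <= size s] share a coset, so [g ^+ (j - i)] lies
    in [H] for some [0 < j - i <= size s], and [j - i] divides the factorial. *)
Lemma finite_index_exponent H : subgroup H -> finite_index H ->
  exists2 m, (0 < m)%N & forall g, H (g ^+ m)%g.
Proof.
move=> sgH [s sH]; exists (size s)`!%N => [|g]; first exact: fact_gt0.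
have [_ HM HV] := sgH.
have /choice[c cP] : forall i : nat, exists x, x \in s /\ H (x^-1 * g ^+ i)%g.
  by move=> i; case: (sH (g ^+ i)%g) => x xs Hx; exists x.
have : ~~ uniq [seq c i | i <- iota 0 (size s).+1].
  apply/negP => /uniq_leq_size leq_s.
  have : {subset [seq c i | i <- iota 0 (size s).+1] <= s}.
    by move=> _ /mapP[i _ ->]; case: (cP i).
  by move/leq_s; rewrite size_map size_iota ltnn.
case/(uniqPn 1%g) => i [j [lt_ij]]; rewrite size_map size_iota => lt_js.
rewrite !(nth_map 0%N) ?size_iota ?(ltn_trans lt_ij) //.
rewrite !nth_iota ?(ltn_trans lt_ij) // !add0n => eq_c.
have Hji : H (g ^+ (j - i))%g.
  have [_ Hi] := cP i; have [_ Hj] := cP j; rewrite -eq_c in Hj.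
  have := HM _ _ (HV _ Hi) Hj.
  by rewrite invgM invgK mulgA mulgK -{1}(subnKC (ltnW lt_ij)) expgnDr mulKg.
have /dvdnP[k ->] : (j - i %| (size s)`!)%N.
  by rewrite dvdn_fact // subn_gt0 lt_ij (leq_trans (leq_subr _ _)).
by rewrite mulnC expgnA; apply: subgroupX.
Qed.

(** Elements with a common label share a left coset, so one representative per attained label
    suffices. *)
Lemma finite_index_rel H (T : finType) (c : Gamma -> T -> Prop) :
    (forall g, exists t, c g t) ->
    (forall g h t, c g t -> c h t -> H (g^-1 * h)%g) ->
  finite_index H.
Proof.
move=> c_total c_fibre.
have /choice[r rP] : forall t, exists r, (exists g, c g t) -> c r t.
  move=> t; have [[g cg]|no_g] := EM (exists g, c g t).
    by exists g.
  by exists 1%g.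
exists [seq r t | t in T] => g; have [t cgt] := c_total g.
exists (r t); first by apply/mapP; exists t; rewrite ?mem_enum.
by apply: (c_fibre _ _ t) => //; apply: rP; exists g.
Qed.

(** The intersection of all conjugates of [H] is the kernel of the action on left cosets, and there
    are finitely many ways to move the cosets listed by [s]. *)
Lemma normal_core H : subgroup H -> finite_index H ->
  exists K : Gamma -> Prop, [/\ subgroup K, finite_index K,
    forall g, K g -> H g & forall g x, K g -> K (x^-1 * g * x)%g].
Proof.
move=> sgH [s sH]; have [H1 HM HV] := sgH.
exists (fun g => forall x, H (x^-1 * g * x)%g); split.
- split=> [x|g h Kg Kh x|g Kg x].
  + by rewrite mulg1 mulVg.
  + by have := HM _ _ (Kg x) (Kh x); rewrite !mulgA mulgK.
  + by have := HV _ (Kg x); rewrite !invgM invgK mulgA.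
(* [t] records where [g] sends each listed coset; as [s] may repeat cosets, [t] need be neither
   unique nor a permutation. *)
- pose c g (t : {ffun 'I_(size s) -> 'I_(size s)}) :=
    forall i, H ((nth 1 s (t i))^-1 * (g * nth 1 s i))%g.
  apply: (@finite_index_rel _ _ c) => [g|g h t cg ch x].
    have /choice[t tP] : forall i : 'I_(size s), exists j : 'I_(size s),
        H ((nth 1 s j)^-1 * (g * nth 1 s i))%g.
      move=> i; have [x xs Hx] := sH (g * nth 1 s i)%g.
      by rewrite -index_mem in xs; exists (Ordinal xs); rewrite nth_index -?index_mem.
    by exists (finfun t) => i; rewrite ffunE.
  have [y ys Hy] := sH x; pose i := Ordinal (etrans (index_mem y s) ys).
  have := HM _ _ (HV _ (cg i)) (ch i); rewrite /= nth_index // => Hgh.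
  have := HM _ _ (HV _ Hy) (HM _ _ Hgh Hy).
  by rewrite !invgM !invgK !mulgA !(mulgVK, mulgK).
- by move=> g /(_ 1%g); rewrite invg1 mul1g mulg1.
by move=> g x Kg y; have := Kg (x * y)%g; rewrite invgM !mulgA.
Qed.

End FiniteIndex.

(** * Semisimple modules over a family of operators *)

Section ModuleTheory.

Variables (F : fieldType) (X : Type).

Section OneModule.

Variables (E : vectType F) (op : X -> 'End(E)).
Implicit Types (U W S C : {vspace E}).

Definition stable U := forall x v, v \in U -> op x v \in U.

(* The zero space is allowed, so that images of simple modules stay simple. *)
Definition simple_or_zero S :=
  stable S /\ forall W, stable W -> (W <= S)%VS -> W = 0%VS \/ W = S.

(** The sum need not be direct, so sums and images stay in this class without choosing a
    subfamily. *)
Definition sum_of_simples U := exists2 s : seq {vspace E},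
  forall S, S \in s -> simple_or_zero S & U = (\sum_(S <- s) S)%VS.

Lemma stable0 : stable 0%VS.
Proof. by move=> x v; rewrite !memv0 => /eqP->; rewrite linear0. Qed.

Lemma stable_cap U W : stable U -> stable W -> stable (U :&: W)%VS.
Proof.
move=> stU stW x v; rewrite !memv_cap => /andP[Uv Wv].
by rewrite stU ?stW.
Qed.

Lemma stable_add U W : stable U -> stable W -> stable (U + W)%VS.
Proof.
move=> stU stW x _ /memv_addP[u Uu [w Ww ->]].
by rewrite linearD memv_add ?stU ?stW.
Qed.

Lemma sum_of_simples_add U W :
  sum_of_simples U -> sum_of_simples W -> sum_of_simples (U + W)%VS.
Proof.
move=> [s sP ->] [t tP ->]; exists (s ++ t) => [S|]; last by rewrite big_cat.
by rewrite mem_cat => /orP[/sP|/tP].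
Qed.

Lemma sum_of_simples_bigadd (I : finType) (U : I -> {vspace E}) :
  (forall i, sum_of_simples (U i)) -> sum_of_simples (\sum_i U i)%VS.
Proof.
move=> sU; elim/big_ind: _ => // [|W1 W2]; last exact: sum_of_simples_add.
by exists [::] => //; rewrite big_nil.
Qed.

(** The complement grows one simple at a time: each simple either lies in [W + C] already, or meets
    it in zero and is added to [C]. *)
Lemma stable_complement W : sum_of_simples fullv -> stable W ->
  exists C, [/\ stable C, (W :&: C)%VS = 0%VS & (W + C)%VS = fullv].
Proof.
move=> [s sP full_s] stW.
suff [C [stC WC0 sWC]] : exists C, [/\ stable C, (W :&: C)%VS = 0%VS
    & (\sum_(S <- s) S <= W + C)%VS].
  by exists C; split=> //; apply/eqP; rewrite eqEsubv subvf full_s.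
elim: s sP {full_s} => [|S s IHs] sP.
  by exists 0%VS; split; rewrite ?capv0 ?big_nil ?sub0v //; apply: stable0.
have [C [stC WC0 sWC]] : exists C, [/\ stable C, (W :&: C)%VS = 0%VS
    & (\sum_(S <- s) S <= W + C)%VS].
  by apply: IHs => S' S's; apply: sP; rewrite inE S's orbT.
have [stS simS] := sP S (mem_head _ _); rewrite big_cons.
have stWC := stable_add stW stC.
have [SWC0|SWC] := simS _ (stable_cap stS stWC) (capvSl _ _); last first.
  by exists C; split; rewrite // subv_add sWC -SWC capvSr.
exists (C + S)%VS; split; first exact: stable_add.
  apply/eqP; rewrite -subv0; apply/subvP => w /memv_capP[Ww].
  case/memv_addP=> c Cc [t St def_w].
  have t0 : t = 0.
    apply/eqP; rewrite -memv0 -SWC0 memv_cap St.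
    by rewrite -[t](addKr c) -def_w addrC memv_add ?memvN.
  by rewrite -WC0 memv_cap Ww def_w t0 addr0.
by rewrite addvA addvC addvS.
Qed.

Lemma stable_projection W : sum_of_simples fullv -> stable W ->
  exists p : 'End(E), [/\ forall x v, p (op x v) = op x (p v),
    forall v, p v \in W & forall v, v \in W -> p v = v].
Proof.
move=> sE stW; have [C [stC WC0 WCf]] := stable_complement sE stW.
exists (daddv_pi W C); split=> [x v|v|v]; [|exact: memv_pi|exact: daddv_pi_id].
have /memv_addP[w Ww [c Cc ->]] : v \in (W + C)%VS by rewrite WCf memvf.
have piC u : u \in C -> daddv_pi W C u = 0.
  move=> Cu; have := @daddv_pi_add _ _ W C u WC0; rewrite WCf memvf => /(_ isT).
  rewrite (@daddv_pi_id _ _ C W) // 1?capvC // => /(canRL (addrK _)) ->.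
  by rewrite subrr.
rewrite !linearD /= (piC c) // (piC (op x c)) ?stC // linear0.
by rewrite !(@daddv_pi_id _ _ W C) ?stW.
Qed.

Lemma ex_simple U : stable U -> U != 0%VS ->
  exists S, [/\ simple_or_zero S, S != 0%VS & (S <= U)%VS].
Proof.
have [d] := ubnP (\dim U); elim: d U => // d IHd U ltUd stU U0.
have [simU|nsimU] := EM (simple_or_zero U); first by exists U.
have [W [stW W0 ltWU]] : exists W, [/\ stable W, W != 0%VS & (W <= U)%VS && (W != U)].
  apply: contrapT => noW; apply: nsimU; split=> // W stW sWU.
  have [->|W0] := eqVneq W 0%VS; [by left | right].
  by apply/eqP; apply: contrapT => /negP WU; apply: noW; exists W; rewrite sWU.
have [sWU neWU] := andP ltWU.
have [|S [simS S0 sSW]] := IHd W _ stW W0; last first.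
  by exists S; split=> //; apply: subv_trans sWU.
rewrite -ltnS (leq_trans _ ltUd) // ltnS ltn_neqAle dimvS // andbT.
by apply: contra neWU; rewrite (dimv_leqif_eq sWU).
Qed.

(** This is the socle, obtained as a sum of simples of largest dimension. *)
Lemma max_sum_of_simples :
  exists2 T, sum_of_simples T & forall S, simple_or_zero S -> (S <= T)%VS.
Proof.
pose P d := `[< exists2 T, sum_of_simples T & \dim T = d >].
have exP : exists d, P d.
  exists 0; apply/asboolP; exists 0%VS; last exact: dimv0.
  by exists [::] => //; rewrite big_nil.
have ubP d : P d -> (d <= \dim {:E})%N.
  by case/asboolP=> T _ <-; apply/dimvS/subvf.
case: (ex_maxnP exP ubP) => _ /asboolP[T sT <-] maxT.
exists T => // S simS.
have sTS : sum_of_simples (T + S)%VS.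
  apply: sum_of_simples_add => //; exists [:: S] => [S'|]; last by rewrite big_seq1.
  by rewrite inE => /eqP->.
apply: subv_trans (addvSr T S) _.
rewrite -(dimv_leqif_sup (addvSl T S)) eqn_leq dimvS ?addvSl //=.
by apply: maxT; apply/asboolP; exists (T + S)%VS.
Qed.

End OneModule.

Section Intertwiners.

Variables (E1 E2 : vectType F) (op1 : X -> 'End(E1)) (op2 : X -> 'End(E2)).
Variable f : 'Hom(E1, E2).
Hypothesis f_equiv : forall x v, f (op1 x v) = op2 x (f v).

Lemma stable_img U : stable op1 U -> stable op2 (f @: U)%VS.
Proof.
move=> stU x _ /memv_imgP[u Uu ->].
by rewrite -f_equiv memv_img ?stU.
Qed.

Lemma stable_preim U : stable op2 U -> stable op1 (f @^-1: U)%VS.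
Proof. by move=> stU x u; rewrite -!memv_preim f_equiv; apply: stU. Qed.

(** A stable subspace of the image is the image of its preimage in [S], which is zero or [S]. *)
Lemma simple_img S : simple_or_zero op1 S -> simple_or_zero op2 (f @: S)%VS.
Proof.
move=> [stS simS]; split=> [|W stW sWS]; first exact: stable_img.
have def_W : W = (f @: (f @^-1: W :&: S))%VS.
  apply/eqP; rewrite eqEsubv; apply/andP; split; apply/subvP => w.
    move=> Ww; have /memv_imgP[u Su def_w] := subvP sWS _ Ww.
    by rewrite def_w memv_img // memv_cap -memv_preim -def_w Ww.
  by case/memv_imgP=> u; rewrite memv_cap -memv_preim => /andP[Wfu _] ->.
case: (simS (f @^-1: W :&: S)%VS) => [|| eqW | eqW]; rewrite ?capvSr //.
- exact/stable_cap/stS/stable_preim.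
- by left; rewrite def_W eqW limg0.
by right; rewrite def_W eqW.
Qed.

Lemma sum_of_simples_img U :
  sum_of_simples op1 U -> sum_of_simples op2 (f @: U)%VS.
Proof.
move=> [s sP ->]; exists [seq (f @: V)%VS | V <- s].
  by move=> _ /mapP[V Vs ->]; apply/simple_img/sP.
by rewrite limg_sum big_map.
Qed.

(** Von Neumann regularity: kernel and image have equivariant projections, and inverting [f] between
    complement and image gives [g]. *)
Lemma intertwiner_regular :
    sum_of_simples op1 fullv -> sum_of_simples op2 fullv ->
  exists2 g : 'Hom(E2, E1), forall x v, g (op2 x v) = op1 x (g v)
    & forall v, f (g (f v)) = f v.
Proof.
move=> s1 s2.
have [|p [p_equiv p_ker p_id]] := @stable_projection _ op1 (lker f) s1.
  by move=> x v; rewrite !memv_ker f_equiv => /eqP->; rewrite linear0.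
have [|q [q_equiv q_img q_id]] := @stable_projection _ op2 (limg f) s2.
  by apply: stable_img => x v _; apply: memvf.
have fK v : f (v - p v) = f v.
  by rewrite linearB /=; have := p_ker v; rewrite memv_ker => /eqP->; rewrite subr0.
have eq_f u v : f u = f v -> u - p u = v - p v.
  move=> fuv; apply/eqP; rewrite -subr_eq0 opprD addrACA -opprD -linearB /=.
  by rewrite p_id ?subrr // memv_ker linearB /= fuv subrr.
(* The linear section [f^-1] need not be equivariant; after [\1 - p] the value depends only on the
   image under [f], by [eq_f]. *)
exists ((\1 - p) \o f^-1 \o q)%VF => [x v|v];
  rewrite !(comp_lfunE, add_lfunE, opp_lfunE, id_lfunE); last first.
  by rewrite fK limg_lfunVK ?q_id ?memv_img ?memvf.
rewrite [RHS]linearB /= -p_equiv; apply: eq_f.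
by rewrite f_equiv !limg_lfunVK.
Qed.

End Intertwiners.

End ModuleTheory.

(** * Matrices, traces and intertwiners *)

Lemma ex_span (F : fieldType) (E : vectType F) (P : E -> Prop) :
  exists2 U : {vspace E}, forall v, P v -> v \in U
    & forall W : {vspace E}, (forall v, P v -> v \in W) -> (U <= W)%VS.
Proof.
pose Q d := `[< exists2 U : {vspace E}, forall v, P v -> v \in U & \dim U = d >].
have exQ : exists d, Q d.
  by exists (\dim {:E}); apply/asboolP; exists fullv => // v _; rewrite memvf.
case: (ex_minnP exQ) => _ /asboolP[U PU <-] minU; exists U => // W PW.
apply/capv_idPl/eqP; rewrite eqEdim capvSl minU //; apply/asboolP.
by exists (U :&: W)%VS => // v Pv; rewrite memv_cap PU ?PW.
Qed.

(** For a full-rank factorisation [e = C *m R], idempotence forces [R *m C = 1%:M], whose size is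
    the rank. *)
Lemma idempotent_trace (F : fieldType) n (e : 'M[F]_n) :
  e *m e = e -> \tr e = (\rank e)%:R.
Proof.
move=> ee; set R := row_base e; set C := col_base e.
have RC1 : R *m C = 1%:M.
  apply: (row_full_inj (col_base_full e)); apply: (row_free_inj (row_base_free e)).
  have CR : C *m R = e := mulmx_base e.
  by rewrite mulmx1 CR mulmxA CR -mulmxA CR.
by rewrite -{1}(mulmx_base e) mxtrace_mulC RC1 mxtrace1.
Qed.

Section MatrixFamilies.

Variables (F : fieldType) (X : Type).

Definition mxop m n (A : 'M[F]_m) : 'End('M[F]_(m, n)) := linfun (mulmx A).

Lemma mxopE m n (A : 'M[F]_m) (v : 'M[F]_(m, n)) : mxop n A v = A *m v.
Proof. exact: lfunE. Qed.

Lemma eq_mx_cV m n (A B : 'M[F]_(m, n)) :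
  (forall v : 'cV_n, A *m v = B *m v) -> A = B.
Proof.
move=> AB; apply/matrixP => i j; have /colP/(_ i) := AB (delta_mx j 0).
by rewrite -!colE !mxE.
Qed.

Lemma lfun_mxP m n (f : 'Hom('cV[F]_m, 'cV[F]_n)) :
  exists A : 'M_(n, m), forall v, f v = A *m v.
Proof.
exists (\matrix_(i, j) f (delta_mx j 0) i 0) => v.
rewrite {1}[v]matrix_sum_delta linear_sum /=; apply/colP => i.
rewrite summxE mxE; apply: eq_bigr => j _.
by rewrite big_ord1 linearZ /= !mxE mulrC.
Qed.

Section Pair.

Variables (m n : nat) (r1 : X -> 'M[F]_m) (r2 : X -> 'M[F]_n).

Definition intertwines (A : 'M[F]_(n, m)) := forall x, A *m r1 x = r2 x *m A.

Lemma mx_intertwiner_regular A :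
    sum_of_simples (fun x => mxop 1 (r1 x)) fullv ->
    sum_of_simples (fun x => mxop 1 (r2 x)) fullv -> intertwines A ->
  exists2 B : 'M_(m, n), forall x, B *m r2 x = r1 x *m B & A *m B *m A = A.
Proof.
move=> s1 s2 A12.
have [|g g_equiv gP] := @intertwiner_regular _ _ _ _ _ _ (linfun (mulmx A)) _ s1 s2.
  by move=> x v; rewrite !lfunE /= !mulmxA A12.
have [B gB] := lfun_mxP g.
exists B => [x|]; apply: eq_mx_cV => v.
  by have := g_equiv x v; rewrite !gB !mxopE !mulmxA.
by have := gP v; rewrite !lfunE /= gB !mulmxA.
Qed.

(* A map of matrices commuting with left multiplications is made of
   intertwiners between columns. *)
Lemma intertwiner_columns k l p q (L : 'Hom('M[F]_(m, k), 'M[F]_(n, l)))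
    (d : 'M[F]_(p, n)) (e : 'M[F]_(m, q)) :
    (forall x Y, L (r1 x *m Y) = r2 x *m L Y) ->
    (forall A, intertwines A -> d *m A *m e = 0) ->
  forall Y, d *m L (e *m Y) = 0.
Proof.
move=> L_equiv de0 Y; apply/eq_mx_cV => w.
have -> : e *m Y = \sum_c (e *m col c Y) *m delta_mx 0 c.
  apply/matrixP => i j; rewrite summxE (bigD1 j) //= big1 => [|c neq_cj].
    by rewrite addr0 !mxE big_ord1 !mxE !eqxx mulr1; apply: eq_bigr => c _; rewrite !mxE.
  by rewrite !mxE big_ord1 !mxE eqxx (eq_sym j) (negPf neq_cj) mulr0.
rewrite mul0mx linear_sum /= mulmx_sumr mulmx_suml big1 // => c _.
(* Feeding in column [c] alone and contracting the output with [w] turns [L] into an intertwiner of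
   column vectors. *)
pose f := (linfun (mulmxr w) \o L \o linfun (mulmxr (delta_mx 0 c)))%VF
  : 'Hom('cV[F]_m, 'cV[F]_n).
have fE v : f v = L (v *m delta_mx 0 c) *m w by rewrite !comp_lfunE !lfunE.
have [A fA] := lfun_mxP f.
have /de0 dAe : intertwines A.
  move=> x; apply: eq_mx_cV => v.
  by rewrite -!mulmxA -!fA !fE -mulmxA L_equiv mulmxA.
by rewrite -mulmxA -fE fA !mulmxA dAe mul0mx.
Qed.

End Pair.

(** A matrix is the sum of its columns, and placing a vector [C *m v] in column [j] is
    equivariant. *)
Lemma sum_of_simples_columns m n p (r : X -> 'M[F]_m) (t : X -> 'M[F]_n)
    (C : 'M[F]_(n, m)) :
    sum_of_simples (fun x => mxop 1 (r x)) fullv -> intertwines r t C ->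
  exists2 U : {vspace 'M[F]_(n, p)}, sum_of_simples (fun x => mxop p (t x)) U
    & forall Y : 'M_(m, p), C *m Y \in U.
Proof.
move=> sr rtC; pose f j : 'Hom('cV[F]_m, 'M[F]_(n, p)) :=
  linfun (mulmxr (delta_mx 0 j) \o mulmx C).
exists (\sum_j (f j @: fullv))%VS.
  apply: sum_of_simples_bigadd => j; apply: sum_of_simples_img sr => x v.
  by rewrite !lfunE /= !mulmxA rtC.
move=> Y; have -> : C *m Y = \sum_j f j (col j Y).
  apply/matrixP => i j; rewrite summxE (bigD1 j) //= big1 => [|c neq_cj].
    rewrite addr0 lfunE /= !mxE big_ord1 !mxE !eqxx mulr1.
    by apply: eq_bigr => c _; rewrite !mxE.
  by rewrite lfunE /= !mxE big_ord1 !mxE eqxx (eq_sym j) (negPf neq_cj) mulr0.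
by apply: memv_sumr => j _; rewrite memv_img ?memvf.
Qed.

End MatrixFamilies.

(** * Clifford's argument for restriction to a normal subgroup *)

Section Restriction.

Variables (Gamma : groupType) (F : fieldType) (n : nat).
Variable H : Gamma -> Prop.

Definition restrict (rho : mxrep Gamma F n) (h : {h | H h}) : 'M[F]_n :=
  rho (sval h).

(** The socle [T] of the restriction is stable under all of [Gamma], since translation by [rho g]
    preserves simplicity. Each [V i] contains a simple, so it meets [T] and lies in it by
    irreducibility. *)
Lemma clifford (rho : mxrep Gamma F n) :
    semisimple rho -> (forall g x, H g -> H (x^-1 * g * x)%g) ->
  sum_of_simples (fun h => mxop 1 (restrict rho h)) fullv.
Proof.
move=> [k [V [irrV sumV _]]] nH; pose op h := mxop 1 (restrict rho h).
have [T sT maxT] := max_sum_of_simples op.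
suff -> : fullv = T by [].
have simple_conj g S : simple_or_zero op S ->
    simple_or_zero op (mxop 1 (rho g) @: S)%VS.
  (* [rho g] intertwines [op] with its twist by conjugation, and normality gives the twist the same
     stable subspaces. *)
  pose op' (h : {h | H h}) := mxop 1 (rho (g * sval h * g^-1)%g) : 'End('cV[F]_n).
  have op'P U : stable op' U <-> stable op U.
    split=> stU h v /stU => [/(_ (exist _ _ (nH _ g (svalP h))))|].
      by rewrite /op' /= !mulgA mulgV mul1g mulgK.
    move=> stV; have := nH _ (g^-1)%g (svalP h); rewrite invgK => Hh.
    exact: stV (exist _ _ Hh).
  move=> simS.
  have [|stS simS'] := @simple_img _ _ _ _ op op' (mxop 1 (rho g)) _ _ simS.
    by move=> h v; rewrite !mxopE !mulmxA -!mxrepM mulgVK.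
  by split=> [|W /op'P stW]; [apply/op'P | apply: simS'].
have rhoT : subrep rho T.
  move=> g v; rewrite -mxopE; case: (sT) => s sP defT.
  rewrite {1}defT => /(memv_img (mxop 1 (rho g))); apply: subvP.
  rewrite limg_sum big_seq; elim/big_ind: _ => [|U W sU sW|U sU].
  - exact: sub0v.
  - by rewrite subv_add sU.
  - exact/maxT/simple_conj/sP.
apply/eqP; rewrite eqEsubv subvf andbT -sumV; apply/subv_sumP => i _.
have [rhoV V0 irrVi] := irrV i.
have [|S [simS S0 sSV]] := @ex_simple _ _ _ op (V i) _ V0.
  by move=> h v; rewrite mxopE; apply: rhoV.
have [|TV0|TV] := irrVi (T :&: V i)%VS _ (capvSr _ _).
- by move=> g v; rewrite !memv_cap => /andP[/rhoT-> /rhoV->].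
- by case/negP: S0; rewrite -subv0 -TV0 subv_cap sSV maxT.
by rewrite -TV capvSl.
Qed.

End Restriction.

(** * Equal traces imply isomorphism *)

Section TraceIsomorphism.

Variables (Gamma : groupType) (F : fieldType) (n : nat).
Variables (rho1 rho2 : mxrep Gamma F n) (H : Gamma -> Prop).
Hypothesis charF0 : [pchar F] =i pred0.
Hypothesis sgH : subgroup H.

Let r1 := restrict (H := H) rho1.
Let r2 := restrict (H := H) rho2.
Hypothesis ss1 : sum_of_simples (fun h => mxop 1 (r1 h)) fullv.
Hypothesis ss2 : sum_of_simples (fun h => mxop 1 (r2 h)) fullv.

(** [d] projects along the image of [P] and [e] onto its kernel: these cut out the summands that the
    partial isomorphism [P] leaves over. *)
Lemma complementary_idempotents (P Q : 'M[F]_n) :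
    intertwines r1 r2 P -> intertwines r2 r1 Q -> P *m Q *m P = P ->
  let d := 1%:M - P *m Q in let e := 1%:M - Q *m P in
  [/\ d *m P = 0, d *m d = d, e *m e = e,
     intertwines r2 r2 d & intertwines r1 r1 e].
Proof.
move=> P12 Q21 PQP d e.
have dP : d *m P = 0 by rewrite mulmxBl mul1mx PQP subrr.
have Pe : P *m e = 0 by rewrite mulmxBr mulmx1 mulmxA PQP subrr.
split=> // [||h|h].
- by rewrite {2}/d mulmxBr mulmx1 mulmxA dP mul0mx subr0.
- by rewrite {1}/e mulmxBl mul1mx -mulmxA Pe mulmx0 subr0.
- by rewrite mulmxBl mulmxBr mul1mx mulmx1 -mulmxA Q21 !mulmxA P12.
- by rewrite mulmxBl mulmxBr mul1mx mulmx1 -mulmxA P12 !mulmxA Q21.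
Qed.

(** Take [P] of maximal rank. As [P] factors through [P + B], maximality makes their column spaces
    equal; [d] kills that of [P] and fixes [B], so [B = 0]. *)
Lemma max_partial_isomorphism : exists P Q : 'M[F]_n,
  [/\ intertwines r1 r2 P, intertwines r2 r1 Q, P *m Q *m P = P
    & forall A, intertwines r1 r2 A -> (1%:M - P *m Q) *m A *m (1%:M - Q *m P) = 0].
Proof.
pose R k := `[< exists2 P : 'M[F]_n, intertwines r1 r2 P & \rank P = k >].
have exR : exists k, R k.
  exists 0; apply/asboolP; exists 0; last exact: mxrank0.
  by move=> h; rewrite mul0mx mulmx0.
have ubR k : R k -> (k <= n)%N by case/asboolP => P _ <-; apply: rank_leq_row.
case: (ex_maxnP exR ubR) => _ /asboolP[P P12 <-] maxP.
have [Q Q21 PQP] := mx_intertwiner_regular ss1 ss2 P12.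
exists P, Q; split=> // A A12.
set d := 1%:M - P *m Q; set e := 1%:M - Q *m P; set B := d *m A *m e.
have [dP dd ee de er] := complementary_idempotents P12 Q21 PQP.
have B12 : intertwines r1 r2 (P + B).
  move=> h; rewrite mulmxDl mulmxDr P12; congr (_ + _).
  by rewrite /B -(mulmxA (d *m A)) er !mulmxA -de -(mulmxA d A) A12 mulmxA.
have defP : P = (P + B) *m (Q *m P).
  rewrite mulmxDl mulmxA PQP /B -[Q *m P](subKr 1%:M) -/e mulmxBr mulmx1.
  by rewrite -(mulmxA _ e e) ee subrr addr0.
(* Transposes appear because this order compares row spaces, while column spaces are meant. *)
have sP : (P^T <= (P + B)^T)%MS by rewrite {1}defP trmx_mul submxMl.
have : (((P + B)^T) <= P^T)%MS.
  rewrite -(mxrank_leqif_sup sP) eqn_leq mxrankS //= !mxrank_tr maxP //.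
  by apply/asboolP; exists (P + B).
case/submxP=> Z /(congr1 trmx); rewrite trmx_mul !trmxK => PB.
have := congr1 (mulmx d) PB; rewrite mulmxDr dP add0r (mulmxA d P) dP mul0mx.
by rewrite /B !mulmxA dd.
Qed.

(** Let [B] be the span of the group acting diagonally on the leftover summands. With no
    intertwiners between these, the projection to [B] preserves the two blocks, so [(e, 0)] lies in
    [B]; equality of traces on [B] then gives [\tr e = 0]. *)
Lemma isomorphic_of_trace :
  (forall h, H h -> \tr (rho1 h) = \tr (rho2 h)) -> isomorphic_on H rho1 rho2.
Proof.
move=> eq_tr; have [P [Q [P12 Q21 PQP no12]]] := max_partial_isomorphism.
set d := 1%:M - P *m Q in no12; set e := 1%:M - Q *m P in no12.
have [dP dd ee de er] := complementary_idempotents P12 Q21 PQP.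
have no21 A : intertwines r2 r1 A -> e *m A *m d = 0.
  move=> A21; set B := e *m A *m d.
  have B21 : intertwines r2 r1 B.
    by move=> h; rewrite /B -(mulmxA (e *m A)) de !mulmxA -er -(mulmxA e A) A21 mulmxA.
  (* [B = B *m C *m B] contains the factor [d *m C *m e], which vanishes by [no12]. *)
  have [C C12 <-] := mx_intertwiner_regular ss2 ss1 B21.
  by rewrite /B -!mulmxA (mulmxA d C) (mulmxA (d *m C)) no12 ?mul0mx ?mulmx0.
pose t h := block_mx (r1 h) 0 0 (r2 h).
pose op h := mxop n (t h).
have t1 : intertwines r1 t (col_mx 1%:M 0).
  by move=> h; rewrite mul_col_mx mul_block_col !mul1mx !mulmx1 !mul0mx !mulmx0 !addr0.
have t2 : intertwines r2 t (col_mx 0 1%:M).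
  by move=> h; rewrite mul_col_mx mul_block_col !mul1mx !mulmx1 !mul0mx !mulmx0 !add0r.
have ss : sum_of_simples op fullv.
  have [U1 sU1 inU1] := sum_of_simples_columns n ss1 t1.
  have [U2 sU2 inU2] := sum_of_simples_columns n ss2 t2.
  suff -> : fullv = (U1 + U2)%VS by apply: sum_of_simples_add.
  apply/esym/eqP; rewrite eqEsubv subvf; apply/subvP => Y _.
  rewrite -[Y]vsubmxK; have := memv_add (inU1 (usubmx Y)) (inU2 (dsubmx Y)).
  by rewrite !mul_col_mx !mul1mx !mul0mx add_col_mx addr0 add0r.
have [B inB minB] := ex_span (fun Y => exists h, Y = col_mx (r1 h *m e) (r2 h *m d)).
have [H1 HM _] := sgH.
have stB : stable op B.
  move=> g Y; rewrite memv_preim; apply: subvP Y; apply: minB => _ [h ->].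
  rewrite -memv_preim; apply: inB; exists (exist _ _ (HM _ _ (svalP g) (svalP h))).
  rewrite mxopE mul_block_col !mul0mx addr0 add0r /r1 /r2 /restrict /= !mxrepM.
  by rewrite !mulmxA.
(* On generators the corrections agree too: moving [P] around the trace turns that of
   [r1 h *m Q *m P] into that of [r2 h *m P *m Q]. *)
have trB Y : Y \in B -> \tr (usubmx Y) = \tr (dsubmx Y).
  pose f : 'Hom('M[F]_(n + n, n), F^o) :=
    linfun ((@mxtrace F n : 'M[F]_n -> F^o) \o mulmx (row_mx 1%:M (- 1%:M))).
  have fE Z : f Z = \tr (usubmx Z) - \tr (dsubmx Z).
    rewrite lfunE /= -{1}[Z]vsubmxK mul_row_col mul1mx mulNmx mul1mx.
    by rewrite raddfB.
  suff /subvP sB : (B <= lker f)%VS.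
    by move/sB; rewrite memv_ker fE subr_eq0 => /eqP.
  apply: minB => _ [h ->]; rewrite memv_ker fE col_mxKu col_mxKd subr_eq0.
  rewrite !mulmxBr !mulmx1 !raddfB /= /r1 /r2 eq_tr; last exact: svalP.
  by rewrite mulmxA mxtrace_mulC mulmxA P12 -mulmxA.
have uB Y : Y \in B -> e *m usubmx Y = usubmx Y.
  suff /subvP sB : (B <= lker (linfun (mulmx (row_mx e 0))
      - linfun (mulmx (row_mx 1%:M 0))))%VS.
    move/sB/eqlfunP; rewrite !lfunE /= -{1 2}[Y]vsubmxK !mul_row_col.
    by rewrite !mul0mx !addr0 mul1mx.
  apply: minB => _ [h ->]; apply/eqlfunP; rewrite !lfunE /= !mul_row_col.
  by rewrite !mul0mx !addr0 mul1mx mulmxA er -mulmxA ee.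
have dB Y : Y \in B -> d *m dsubmx Y = dsubmx Y.
  suff /subvP sB : (B <= lker (linfun (mulmx (row_mx 0 d))
      - linfun (mulmx (row_mx 0 1%:M))))%VS.
    move/sB/eqlfunP; rewrite !lfunE /= -{1 2}[Y]vsubmxK !mul_row_col.
    by rewrite !mul0mx !add0r mul1mx.
  apply: minB => _ [h ->]; apply/eqlfunP; rewrite !lfunE /= !mul_row_col.
  by rewrite !mul0mx !add0r mul1mx mulmxA de -mulmxA dd.
have edB : col_mx e d \in B.
  apply: inB; exists (exist _ _ H1); rewrite /r1 /r2 /restrict /= !mxrep1.
  by rewrite !mul1mx.
have [p [p_equiv pB p_id]] := stable_projection ss stB.
(* The off-diagonal block of [p] is equivariant from the first module to the second, and [d], [e]
   compress it to the leftover summands. *)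
have p1 : dsubmx (p (col_mx e 0)) = 0.
  pose L := (linfun (mulmx (row_mx 0 1%:M)) \o p
             \o linfun (mulmx (col_mx 1%:M 0)))%VF : 'End('M[F]_n).
  have LE Y : L Y = dsubmx (p (col_mx Y 0)).
    rewrite !comp_lfunE !lfunE /= mul_col_mx mul1mx mul0mx.
    by rewrite -{1}[p _]vsubmxK mul_row_col mul0mx add0r mul1mx.
  rewrite -dB ?pB // -LE -[e]mulmx1; apply: intertwiner_columns no12 _ => h Y.
  have -> : L (r1 h *m Y) = dsubmx (p (op h (col_mx Y 0))).
    by rewrite LE mxopE mul_block_col !mulmx0 mul0mx !addr0.
  by rewrite p_equiv LE mxopE -{1}[p _]vsubmxK mul_block_col col_mxKd mul0mx add0r.
have p2 : usubmx (p (col_mx 0 d)) = 0.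
  pose L := (linfun (mulmx (row_mx 1%:M 0)) \o p
             \o linfun (mulmx (col_mx 0 1%:M)))%VF : 'End('M[F]_n).
  have LE Y : L Y = usubmx (p (col_mx 0 Y)).
    rewrite !comp_lfunE !lfunE /= mul_col_mx mul1mx mul0mx.
    by rewrite -{1}[p _]vsubmxK mul_row_col mul0mx addr0 mul1mx.
  rewrite -uB ?pB // -LE -[d]mulmx1; apply: intertwiner_columns no21 _ => h Y.
  have -> : L (r2 h *m Y) = usubmx (p (op h (col_mx 0 Y))).
    by rewrite LE mxopE mul_block_col !mulmx0 mul0mx !add0r.
  by rewrite p_equiv LE mxopE -{1}[p _]vsubmxK mul_block_col col_mxKu mul0mx addr0.
have p_e : usubmx (p (col_mx e 0)) = e.
  have : usubmx (p (col_mx e d)) = e by rewrite p_id ?col_mxKu.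
  have -> : col_mx e d = col_mx e 0 + col_mx 0 d by rewrite add_col_mx addr0 add0r.
  by rewrite !linearD /= p2 addr0.
have tr_e : \tr e = 0 by rewrite -p_e trB ?pB // p1 mxtrace0.
have e0 : e = 0.
  have := idempotent_trace ee; rewrite tr_e => /esym/eqP.
  by rewrite (proj1 (pcharf0P F) charF0) mxrank_eq0 => /eqP.
exists P; last by move=> h Hh; apply: (P12 (exist _ _ Hh)).
have /mulmx1_unit[] : Q *m P = 1%:M by apply/eqP; rewrite eq_sym -subr_eq0 -/e e0.
by [].
Qed.

End TraceIsomorphism.

(** * Matrix coefficients of finite-dimensional representations *)

Section RepresentativeFunctions.

Variables (Gamma : groupType) (F : fieldType).

Definition repfun (f : Gamma -> F) := exists N (tau : mxrep Gamma F N) (u : 'rV_N) (v : 'cV_N),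
  forall g, f g = (u *m tau g *m v) 0 0.

Lemma ex_mxrep N (tau : Gamma -> 'M[F]_N) : tau 1%g = 1%:M ->
    (forall g h, tau (g * h)%g = tau g *m tau h) ->
  exists tau' : mxrep Gamma F N, tau' =1 tau.
Proof.
move=> tau1 tauM; have tauU g : tau g \in unitmx.
  by have /mulmx1_unit[] : tau g *m tau g^-1%g = 1%:M by rewrite -tauM mulgV.
by exists (MxRep tauU tau1 tauM).
Qed.

Lemma repfun_ext f h : f =1 h -> repfun f -> repfun h.
Proof. by move=> fh [N [tau [u [v E]]]]; exists N, tau, u, v => g; rewrite -fh. Qed.

Lemma repfun_const c : repfun (fun=> c).
Proof.
have [|//|tau tauE] := @ex_mxrep 1 (fun=> 1%:M); first by [].
  by move=> _ _; rewrite mulmx1.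
exists 1%N, tau, c%:M, 1%:M => g.
by rewrite tauE !mulmx1 mxE eqxx.
Qed.

Lemma repfun_entry n (rho : mxrep Gamma F n) i j : repfun (fun g => rho g i j).
Proof.
exists n, rho, (delta_mx 0 i), (delta_mx j 0) => g.
by rewrite -rowE -colE !mxE.
Qed.

(** In the direct sum both functions use the same vector [v], so both zero sets are linear
    conditions on one orbit [tau g *m v]. *)
Lemma repfun_pair f h : repfun f -> repfun h ->
  exists N (tau : mxrep Gamma F N) (u w : 'rV_N) (v : 'cV_N),
    forall g, f g = (u *m tau g *m v) 0 0 /\ h g = (w *m tau g *m v) 0 0.
Proof.
move=> [N [tau [u [v fE]]]] [N' [tau' [u' [v' hE]]]].
have [||t tE] := @ex_mxrep _ (fun g => block_mx (tau g) 0 0 (tau' g)).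
- by rewrite !mxrep1 -scalar_mx_block.
- by move=> g k; rewrite mulmx_block !mul0mx !mulmx0 !addr0 !add0r !mxrepM.
exists _, t, (row_mx u 0), (row_mx 0 u'), (col_mx v v') => g.
rewrite tE !mul_row_block !mul0mx !mulmx0 !addr0 !add0r !mul_row_col.
by rewrite !mul0mx addr0 add0r.
Qed.

Lemma repfun_add f h : repfun f -> repfun h -> repfun (fun g => f g + h g).
Proof.
move=> rf rh; have [N [t [u [w [v E]]]]] := repfun_pair rf rh.
by exists N, t, (u + w), v => g; have [-> ->] := E g; rewrite !mulmxDl [RHS]mxE.
Qed.

Lemma repfun_mul f h : repfun f -> repfun h -> repfun (fun g => f g * h g).
Proof.
move=> [N [tau [u [v fE]]]] [N' [tau' [u' [v' hE]]]].
have [||t tE] := @ex_mxrep _ (fun g => tau g *t tau' g).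
- rewrite !mxrep1; apply/matrixP => i j.
  case: (mxtens_indexP i) => i1 i2; case: (mxtens_indexP j) => j1 j2.
  rewrite tensmxE !mxE (inj_eq (can_inj (@mxtens_indexK _ _))) xpair_eqE.
  by rewrite -natrM mulnb.
- by move=> g k; rewrite !mxrepM -tensmx_mul.
exists _, t, (u *t u'), (v *t v') => g.
rewrite tE fE hE -tensmxE -!tensmx_mul.
by congr (fun_of_matrix _ _ _); apply: val_inj.
Qed.

(** * Irreducible components and their translates *)

Section Components.

Variables (N : nat) (tau : mxrep Gamma F N) (v : 'cV[F]_N).
Implicit Types (U W M : {vspace 'cV[F]_N}).

(* The subspace [U] stands for the closed set of all [x] with
   [tau x *m v \in U]; these sets form the closed sets, of bounded degree, of a
   Noetherian topology on [Gamma] for which translations are continuous. *)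
Definition in_closed U (x : Gamma) := tau x *m v \in U.

(* Covers by the empty list are included, so irreducible sets have points. *)
Definition irreducible_closed U := forall s : seq {vspace 'cV[F]_N},
  (forall x, in_closed U x -> exists2 W, W \in s & in_closed W x) ->
  exists2 W, W \in s & (U <= W)%VS.

(** If [U] is reducible, its points are covered by the [U :&: W] with [W] not containing [U], all of
    smaller dimension. *)
Lemma irreducible_decomposition U : exists2 s : seq {vspace 'cV[F]_N},
  forall M, M \in s -> irreducible_closed M
  & forall x, in_closed U x -> exists2 M, M \in s & in_closed M x.
Proof.
have [d] := ubnP (\dim U); elim: d U => // d IHd U ltUd.
have [irrU|nirrU] := EM (irreducible_closed U).
  exists [:: U] => [M|x Ux]; first by rewrite inE => /eqP->.
  by exists U; rewrite ?mem_head.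
have [t [cov nUt]] : exists t : seq {vspace 'cV[F]_N},
    (forall x, in_closed U x -> exists2 W, W \in t & in_closed W x)
    /\ (forall W, W \in t -> ~~ (U <= W)%VS).
  apply: contrapT => no; apply: nirrU => t cov; apply: contrapT => no_t.
  case: no; exists t; split=> // W Wt; apply/negP => sUW.
  by case: no_t; exists W.
suff [s irr_s cov_s] : exists2 s : seq {vspace 'cV[F]_N},
    forall M, M \in s -> irreducible_closed M
    & forall x, in_closed U x -> (exists2 W, W \in t & in_closed W x) ->
      exists2 M, M \in s & in_closed M x.
  by exists s => // x Ux; apply: cov_s => //; apply: cov.
elim: t nUt {cov} => [|W t IHt] nUt; first by exists [::] => // x _ [].
have [|s1 irr1 cov1] := IHt; first by move=> V Vt; apply: nUt; rewrite inE Vt orbT.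
have [|s2 irr2 cov2] := IHd (U :&: W)%VS.
  rewrite -ltnS (leq_trans _ ltUd) // ltnS ltn_neqAle dimvS ?capvSl // andbT.
  rewrite (dimv_leqif_eq (capvSl U W)).
  by apply: contra (nUt W (mem_head _ _)) => /eqP <-; apply: capvSr.
exists (s1 ++ s2) => [M|x Ux [V]]; first by rewrite mem_cat => /orP[/irr1|/irr2].
rewrite inE => /predU1P[-> Wx|Vt Vx].
  have [|M Ms Mx] := cov2 x; first by rewrite /in_closed memv_cap; apply/andP.
  by exists M; rewrite // mem_cat Ms orbT.
have [|M Ms Mx] := cov1 x Ux; first by exists V.
by exists M; rewrite // mem_cat Ms.
Qed.

Definition translate (g : Gamma) U : {vspace 'cV[F]_N} := (mxop 1 (tau g) @: U)%VS.

Lemma translateM g h U : translate (g * h)%g U = translate g (translate h U).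
Proof.
rewrite /translate -limg_comp; congr lfun_img; apply/lfunP => w.
by rewrite comp_lfunE !mxopE mxrepM mulmxA.
Qed.

Lemma translate1 U : translate 1%g U = U.
Proof.
rewrite /translate -[RHS]lim1g; congr lfun_img; apply/lfunP => w.
by rewrite mxopE mxrep1 mul1mx id_lfunE.
Qed.

Lemma translateK g U : translate g^-1%g (translate g U) = U.
Proof. by rewrite -translateM mulVg translate1. Qed.

Lemma translateS g U W : (U <= W)%VS -> (translate g U <= translate g W)%VS.
Proof. exact: limgS. Qed.

Lemma dim_translate g U : \dim (translate g U) = \dim U.
Proof.
apply: limg_dim_eq; apply/eqP; rewrite -subv0; apply/subvP => w.
rewrite memv_cap memv_ker mxopE memv0 => /andP[_ /eqP tw0].
by rewrite -(mulKmx (mxrep_unit tau g) w) tw0 mulmx0.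
Qed.

Lemma in_translate g U x : in_closed U x -> in_closed (translate g U) (g * x)%g.
Proof. by rewrite /in_closed mxrepM -mulmxA -[tau g *m _]mxopE; apply: memv_img. Qed.

Lemma irreducible_translate g U :
  irreducible_closed U -> irreducible_closed (translate g U).
Proof.
move=> irrU s cov; have [|_ /mapP[W Ws ->] sUW] :=
    irrU [seq translate g^-1%g V | V <- s].
  move=> x /(in_translate g)/cov[W Ws /(in_translate g^-1%g)].
  by rewrite mulKg => Wx; exists (translate g^-1%g W); rewrite ?map_f.
exists W => //; have := translateS g sUW.
by rewrite -translateM mulgV translate1.
Qed.

(** A translate of a member [M] of largest dimension is irreducible, so it lies in a member of [s]
    and equals it. The orbit of [M] is thus finite, and stabilisers have finite index. *)
Lemma component_of_1 : exists (M : {vspace 'cV[F]_N}) (H : Gamma -> Prop),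
  [/\ irreducible_closed M, subgroup H, finite_index H
    & forall h, H h -> in_closed M h].
Proof.
have [s irr_s cov_s] := irreducible_decomposition fullv.
have [M1 M1s _] := cov_s 1%g (memvf _).
have [M Ms maxM] : exists2 M, M \in s & forall U, U \in s -> (\dim U <= \dim M)%N.
  have exP : exists d, has (fun U => \dim U == d) s.
    by exists (\dim M1); apply/hasP; exists M1.
  have ubP d : has (fun U => \dim U == d) s -> (d <= \dim {:'cV[F]_N})%N.
    by case/hasP=> U _ /eqP <-; apply/dimvS/subvf.
  case: (ex_maxnP exP ubP) => _ /hasP[M Ms /eqP <-] maxM; exists M => // U Us.
  by apply: maxM; apply/hasP; exists U.
have irrM := irr_s _ Ms.
have transM g : translate g M \in s.
  have [x _|U Us sMU] := @irreducible_translate g _ irrM s.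
    by apply: cov_s; apply: memvf.
  suff -> : translate g M = U by [].
  by apply/eqP; rewrite eqEdim sMU dim_translate maxM.
(* Without points, [M] would be covered by the empty list. *)
have [x0 Mx0] : exists x, in_closed M x.
  by apply: contrapT => no; case: (irrM [::]) => // x Mx; case: no; exists x.
pose M0 := translate x0^-1%g M; pose H h := translate h M0 = M0.
have M01 : in_closed M0 1%g by rewrite -(mulVg x0); apply: in_translate.
have H1 : H 1%g by apply: translate1.
have HV h : H h -> H h^-1%g by move=> Hh; rewrite /H -{1}Hh translateK.
exists M0, H; split=> //.
- exact: irreducible_translate.
- by split=> // g h Hg Hh; rewrite /H translateM Hh.
- pose c g (i : 'I_(size s)) := translate g M0 = nth 0%VS s i.
  apply: (@finite_index_rel _ _ _ c) => [g|g h i cg ch].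
    have gMs : (index (translate g M0) s < size s)%N.
      by rewrite index_mem /M0 -translateM.
    by exists (Ordinal gMs); rewrite /c nth_index // -index_mem.
  by rewrite /H translateM ch -cg translateK.
- by move=> h Hh; rewrite -Hh -{2}(mulg1 h); apply: in_translate.
Qed.

End Components.

(** The zero sets of [f] and [h] cover the component, so one contains it; it cannot be that of [h],
    because the component contains [1]. *)
Lemma repfun_domain_on_finite_index (f h : Gamma -> F) : repfun f -> repfun h ->
    (forall g, f g * h g = 0) -> h 1%g != 0 ->
  exists H : Gamma -> Prop,
    [/\ subgroup H, finite_index H & forall x, H x -> f x = 0].
Proof.
move=> rf rh fh0 h1; have [N [tau [u [w [v E]]]]] := repfun_pair rf rh.
have [M [H [irrM sgH fiH HM]]] := component_of_1 tau v.
have [H1 _ _] := sgH.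
have kerE (z : 'rV_N) x : in_closed tau v (lker (linfun (mulmx z : 'cV_N -> 'M_1))) x
    <-> (z *m tau x *m v) 0 0 = 0.
  rewrite /in_closed memv_ker lfunE /= mulmxA; split=> [/eqP->|z0].
    by rewrite mxE.
  by apply/eqP/matrixP => i j; rewrite !ord1 z0 mxE.
exists H; split=> // x Hx; have [fx hx] := E x.
pose kf := lker (linfun (mulmx u : 'cV_N -> 'M_1)).
pose kh := lker (linfun (mulmx w : 'cV_N -> 'M_1)).
have [y _|W] := irrM [:: kf; kh].
  have := fh0 y; have [-> ->] := E y => /eqP.
  rewrite mulf_eq0 => /orP[]/eqP/kerE ?; [exists kf | exists kh] => //.
    by rewrite mem_head.
  by rewrite inE mem_head orbT.
rewrite !inE => /orP[]/eqP-> /subvP sM.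
  by rewrite fx; apply/kerE/sM/HM.
by case/eqP: h1; have [_ ->] := E 1%g; apply/kerE/sM/HM.
Qed.
End RepresentativeFunctions.

(** * Polynomials in a power of the variable, modulo [chi] *)

Section PowerResidues.

Variables (F : fieldType) (N m : nat).
Implicit Types chi : {poly F}.

(** On row vectors of coefficients this is the matrix of [q \Po 'X^m] reduced modulo [chi], as a
    linear function of [q]. *)
Definition power_residues chi : 'M[F]_N :=
  \matrix_(i < N) poly_rV ('X^(m * i) %% chi).

Lemma mul_power_residues chi (p : 'rV_N) :
  p *m power_residues chi = poly_rV ((rVpoly p \Po 'X^m) %% chi).
Proof.
rewrite mulmx_sum_row {2}[p]matrix_sum_delta big_ord1.
have -> : rVpoly (\sum_j p 0 j *: delta_mx 0 j) = \sum_j p 0 j *: 'X^j.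
  rewrite linear_sum; apply: eq_bigr => j _.
  by rewrite linearZ /= rVpoly_delta.
rewrite (big_morph (fun q => poly_rV ((q \Po 'X^m) %% chi)) (id1 := 0) (op1 := +%R)).
- apply: eq_bigr => i _; rewrite rowK comp_polyZ comp_Xn_poly modpZl linearZ /=.
  by rewrite -exprM.
- by move=> p1 p2; rewrite comp_polyD modpD linearD.
by rewrite comp_poly0 mod0p linear0.
Qed.

Lemma power_residues_generate chi : chi != 0 -> (size chi <= N.+1)%N ->
  \det (power_residues chi) != 0 -> exists q, chi %| 'X - (q \Po 'X^m).
Proof.
move=> chi0 sz_chi detW; pose W := power_residues chi.
have uW : W \in unitmx by rewrite unitmxE unitfE.
pose p := poly_rV ('X %% chi) *m invmx W.
exists (rVpoly p); apply/modp_eq0P; rewrite modpD modpN; apply/eqP.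
have szmod (r : {poly F}) : (size (r %% chi)%R <= N)%N.
  by rewrite -ltnS (leq_trans _ sz_chi) // ltn_modp.
rewrite subr_eq0 -(poly_rV_K (szmod 'X)) -(poly_rV_K (szmod (_ \Po _))).
by rewrite -mul_power_residues mulmxKV.
Qed.

(** A kernel vector is a nonzero [q] of size at most [N] such that [('X - 1) ^+ N] divides
    [q \Po 'X^m]. But substituting ['X^m] preserves the multiplicity of the root [1], which is below
    [N]. *)
Lemma det_power_residues_unipotent : [pchar F] =i pred0 -> (0 < m)%N ->
  \det (power_residues (('X - 1) ^+ N)) != 0.
Proof.
move=> charF0 m_gt0; apply/negP => /det0P[p p0].
rewrite mul_power_residues -polyC1; set chi := (_ ^+ N) => /(congr1 rVpoly).
have sz_chi : size chi = N.+1 by rewrite size_exp_XsubC.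
have chi0 : chi != 0 by rewrite -size_poly_eq0 sz_chi.
rewrite linear0 poly_rV_K => [/modp_eq0P|]; last by rewrite -ltnS -sz_chi ltn_modp.
set q := rVpoly p; have q0 : q != 0.
  by apply: contra p0 => /eqP q0; rewrite -(rVpolyK p) -/q q0 linear0.
have [a [r]] := multiplicity_XsubC q 1; rewrite q0 /= => r1 defq.
have aN : (a < N)%N.
  have : (size q <= N)%N by apply: size_poly.
  rewrite defq size_Mmonic ?monicXn ?monic_exp ?monicXsubC //.
    rewrite size_exp_XsubC addnS /=; apply: leq_trans.
    rewrite -add1n leq_add2r size_poly_gt0.
    by apply: contra r1 => /eqP->; rewrite root0.
  by apply: contra r1 => /eqP->; rewrite root0.
rewrite defq comp_polyM rmorphXn /= comp_polyB comp_polyX comp_polyC polyC1.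
rewrite subrX1 exprMn mulrCA mulrC -polyC1; set u := \sum_(i < m) _.
(* The cofactor is prime to ['X - 1]: at [1], [u] takes the value [m], nonzero in characteristic
   zero, and [r] does not vanish. *)
rewrite Gauss_dvdpr; last first.
  rewrite coprimep_expl // coprimep_sym coprimep_XsubC rootM negb_or.
  rewrite !rootE horner_comp hornerXn expr1n r1 horner_exp expf_eq0 negb_and.
  rewrite horner_sum (eq_bigr (fun=> 1)) => [|i _]; last by rewrite hornerXn expr1n.
  by rewrite sumr_const card_ord (proj1 (pcharf0P F) charF0) -lt0n m_gt0 orbT.
by rewrite dvdp_Pexp2l ?size_XsubC // leqNgt aN.
Qed.

End PowerResidues.

Lemma trace_of_power_traces (F : fieldType) n m (A B : 'M[F]_n.+1) (q : {poly F}) :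
    char_poly A * char_poly B %| 'X - (q \Po 'X^m) ->
    (forall i, \tr (A ^+ (m * i)) = \tr (B ^+ (m * i))) ->
  \tr A = \tr B.
Proof.
move=> dvd_q eq_tr.
have trP (C : 'M[F]_n.+1) : char_poly C %| 'X - (q \Po 'X^m) ->
    \tr C = \sum_(i < size q) q`_i * \tr (C ^+ (m * i)).
  case/dvdpP=> z /(congr1 (horner_mx C)); rewrite rmorphM /= Cayley_Hamilton mulr0.
  rewrite rmorphB /= horner_mx_X => /eqP; rewrite subr_eq0 => /eqP {1}->.
  rewrite comp_polyE !raddf_sum /=; apply: eq_bigr => i _.
  by rewrite -exprM linearZ /= rmorphXn /= horner_mx_X mxtraceZ.
rewrite !trP; first by apply: eq_bigr => i _; rewrite eq_tr.
- exact: dvdp_trans (dvdp_mull _ (dvdpp _)) dvd_q.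
- exact: dvdp_trans (dvdp_mulr _ (dvdpp _)) dvd_q.
Qed.

(** * Polynomial expressions in matrix coefficients *)

Section PolynomialClosure.

Variables (T : Type) (R : comNzRingType) (S : (T -> R) -> Prop).
Hypothesis S_ext : forall f h, f =1 h -> S f -> S h.
Hypothesis S_const : forall c, S (fun=> c).
Hypothesis S_add : forall f h, S f -> S h -> S (fun x => f x + h x).
Hypothesis S_mul : forall f h, S f -> S h -> S (fun x => f x * h x).

Lemma closed_sum (I : Type) (s : seq I) (f : I -> T -> R) :
  (forall i, S (f i)) -> S (fun x => \sum_(i <- s) f i x).
Proof.
move=> Sf; elim: s => [|i s IHs].
  by apply: S_ext (S_const 0) => x; rewrite big_nil.
by apply: S_ext (S_add (Sf i) IHs) => x; rewrite big_cons.
Qed.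

Lemma closed_prod (I : Type) (s : seq I) (f : I -> T -> R) :
  (forall i, S (f i)) -> S (fun x => \prod_(i <- s) f i x).
Proof.
move=> Sf; elim: s => [|i s IHs].
  by apply: S_ext (S_const 1) => x; rewrite big_nil.
by apply: S_ext (S_mul (Sf i) IHs) => x; rewrite big_cons.
Qed.

(** The class [S] is abstract because determinants are needed both over [F] and over [{poly F}], the
    latter for characteristic polynomials. *)
Lemma closed_det n (A : T -> 'M[R]_n) :
  (forall i j, S (fun x => A x i j)) -> S (fun x => \det (A x)).
Proof.
move=> SA; apply: closed_sum => s; apply: S_mul; first exact: S_const.
by apply: closed_prod => i; apply: SA.
Qed.

End PolynomialClosure.

Section RepresentativePolynomials.

Variables (Gamma : groupType) (F : fieldType).

Definition reppoly (P : Gamma -> {poly F}) := forall k, repfun (fun g => (P g)`_k).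

Lemma reppoly_ext P Q : P =1 Q -> reppoly P -> reppoly Q.
Proof. by move=> PQ rP k; apply: repfun_ext (rP k) => g; rewrite PQ. Qed.

Lemma reppoly_const p : reppoly (fun=> p).
Proof. by move=> k; apply: repfun_const. Qed.

Lemma reppoly_add P Q : reppoly P -> reppoly Q -> reppoly (fun g => P g + Q g).
Proof.
move=> rP rQ k; apply: repfun_ext (repfun_add (rP k) (rQ k)) => g.
by rewrite coefD.
Qed.

Lemma reppoly_mul P Q : reppoly P -> reppoly Q -> reppoly (fun g => P g * Q g).
Proof.
move=> rP rQ k.
apply: (@repfun_ext _ _ (fun g => \sum_(i < k.+1) (P g)`_i * (Q g)`_(k - i))).
  by move=> g; rewrite coefM.
apply: (closed_sum (@repfun_ext _ _) (@repfun_const _ _) (@repfun_add _ _)) => i.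
exact: repfun_mul.
Qed.

Lemma reppolyC f : repfun f -> reppoly (fun g => (f g)%:P).
Proof.
move=> rf [|k]; first by apply: repfun_ext rf => g; rewrite coefC.
by apply: repfun_ext (repfun_const _ 0) => g; rewrite coefC.
Qed.

Lemma reppoly_char_poly n (rho : mxrep Gamma F n) :
  reppoly (fun g => char_poly (rho g)).
Proof.
apply: (closed_det reppoly_ext reppoly_const reppoly_add reppoly_mul) => i j.
apply: (@reppoly_ext (fun g => 'X *+ (i == j) + (-1) * (rho g i j)%:P)).
  by move=> g; rewrite !mxE mulN1r.
apply: reppoly_add (reppoly_const _) (reppoly_mul (reppoly_const _) _).
exact/reppolyC/repfun_entry.
Qed.

(** Since [chi g] is monic of constant degree, passing from ['X^k] to the next power only subtracts
    a multiple of [chi g] by the top coefficient of the shifted residue. *)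
Lemma reppoly_modX N (chi : Gamma -> {poly F}) k :
    (forall g, chi g \is monic) -> (forall g, size (chi g) = N.+2) ->
  reppoly chi -> reppoly (fun g => 'X^k %% chi g).
Proof.
move=> mon_chi sz_chi r_chi; elim: k => [|k IHk].
  apply: reppoly_ext (reppoly_const 1) => g.
  by rewrite modp_small // size_poly1 sz_chi.
pose P g := 'X * ('X^k %% chi g) + ((-1) * ('X^k %% chi g)`_N)%:P * chi g.
apply: (@reppoly_ext P) => [g|].
  have chi0 := monic_neq0 (mon_chi g).
  have -> : 'X^(k.+1) %% chi g = P g %% chi g.
    by rewrite modpD modp_mull addr0 modp_mul exprS.
  rewrite modp_small // sz_chi ltnS /P; set r := (_ %% _)%R.
  have sz_r : (size r <= N.+1)%N by rewrite -ltnS -(sz_chi g) ltn_modp.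
  apply/leq_sizeP => j; rewrite leq_eqVlt => /predU1P[<-|lt_Nj].
    rewrite coefD coefXM coefCM /=.
    have /monicP : chi g \is monic by [].
    by rewrite /lead_coef sz_chi /= => ->; rewrite mulr1 mulN1r subrr.
  rewrite coefD coefXM coefCM (nth_default _ (_ : size (chi g) <= j)%N) ?sz_chi //.
  rewrite mulr0 addr0; case: j lt_Nj => //= j lt_Nj.
  by rewrite nth_default // (leq_trans sz_r).
apply: reppoly_add; first by apply: reppoly_mul => //; apply: reppoly_const.
apply: reppoly_mul => //; apply: reppolyC.
by apply: repfun_mul (repfun_const _ _) (IHk N).
Qed.

End RepresentativePolynomials.

(** * From power characters to traces, and the equivalence *)

Lemma mxrepX (Gamma : groupType) (F : fieldType) n (rho : mxrep Gamma F n.+1) g k :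
  rho (g ^+ k)%g = rho g ^+ k.
Proof.
elim: k => [|k IHk]; first by rewrite expg0 mxrep1 expr0.
by rewrite expgS mxrepM IHk exprS.
Qed.

Lemma trace_eq_on_finite_index (Gamma : groupType) (F : fieldType) (n m : nat)
    (rho1 rho2 : mxrep Gamma F n) : [pchar F] =i pred0 -> (0 < m)%N ->
    (forall g, power_character m rho1 g = power_character m rho2 g) ->
  exists H : Gamma -> Prop, [/\ subgroup H, finite_index H
    & forall h, H h -> \tr (rho1 h) = \tr (rho2 h)].
Proof.
(* In dimension zero traces are empty sums; positive dimension gives the matrix ring used for
   Cayley-Hamilton. *)
case: n rho1 rho2 => [|n] rho1 rho2 charF0 m_gt0 eq_pow.
  exists (fun=> True); split=> // [|h _]; last by rewrite /mxtrace !big_ord0.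
  by exists [:: 1%g] => g; exists 1%g; rewrite ?mem_head.
pose N := (n.+1 + n.+1)%N; pose chi g := char_poly (rho1 g) * char_poly (rho2 g).
have mon_chi g : chi g \is monic by rewrite monicMl ?char_poly_monic.
have sz_chi g : size (chi g) = N.+1.
  by rewrite size_Mmonic ?char_poly_monic ?monic_neq0 ?char_poly_monic
     // !size_char_poly addnS.
pose f g := \tr (rho1 g) - \tr (rho2 g).
pose h g := \det (power_residues N m (chi g)).
have rtr (rho : mxrep Gamma F n.+1) : repfun (fun g => \tr (rho g)).
  apply: (closed_sum (@repfun_ext _ _) (@repfun_const _ _) (@repfun_add _ _)) => i.
  exact: repfun_entry.
have rf : repfun f.
  apply: (@repfun_ext _ _ (fun g => \tr (rho1 g) + (-1) * \tr (rho2 g))).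
    by move=> g; rewrite mulN1r.
  exact: repfun_add (rtr _) (repfun_mul (repfun_const _ _) (rtr _)).
have rh : repfun h.
  apply: (closed_det (@repfun_ext _ _) (@repfun_const _ _) (@repfun_add _ _)
    (@repfun_mul _ _)) => i j.
  apply: (@repfun_ext _ _ (fun g => ('X^(m * i) %% chi g)`_j)).
    by move=> g; rewrite !mxE.
  apply: (@reppoly_modX _ _ (n + n.+1)) => //.
  by apply: reppoly_mul; apply: reppoly_char_poly.
have fh0 g : f g * h g = 0.
  have [->|h0] := eqVneq (h g) 0; first by rewrite mulr0.
  have [||q] := power_residues_generate _ _ h0.
  - exact: monic_neq0.
  - by rewrite sz_chi.
  rewrite /f => /trace_of_power_traces ->; rewrite ?subrr ?mul0r // => i.
  by rewrite -!mxrepX mulnC expgnA; apply: eq_pow.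
(* At the identity [chi] is the unipotent polynomial [('X - 1) ^+ N]. *)
have h1 : h 1%g != 0.
  suff -> : h 1%g = \det (power_residues N m (('X - 1) ^+ N)).
    exact: det_power_residues_unipotent.
  rewrite /h /chi !mxrep1; congr (\det (power_residues _ _ _)).
  have -> : char_poly (1%:M : 'M[F]_n.+1) = ('X - 1) ^+ n.+1.
    rewrite char_poly_trig ?scalar_mx_is_trig // (eq_bigr (fun=> 'X - 1)).
      by rewrite prodr_const card_ord.
    by move=> i _; rewrite mxE eqxx.
  by rewrite -exprD.
have [H [sgH fiH fH]] := repfun_domain_on_finite_index rf rh fh0 h1.
by exists H; split=> // x Hx; apply/eqP; rewrite -subr_eq0; apply/eqP/fH.
Qed.

Theorem theorem2p2 (Gamma : groupType) (F : fieldType) (n : nat)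
    (rho1 rho2 : mxrep Gamma F n) :
  [pchar F] =i pred0 -> semisimple rho1 -> semisimple rho2 ->
  potentially_equivalent rho1 rho2 <->
  exists2 m : nat, (1 <= m)%N &
    forall g : Gamma, power_character m rho1 g = power_character m rho2 g.
Proof.
move=> charF0 ss1 ss2; split=> [[H [sgH fiH [P uP PH]]]|[m m_gt0 eq_pow]].
  have [m m_gt0 Hm] := finite_index_exponent sgH fiH.
  exists m => // g; rewrite /power_character.
  have -> : rho1 (g ^+ m)%g = invmx P *m (rho2 (g ^+ m)%g *m P).
    by rewrite -PH ?mulKmx.
  by rewrite mxtrace_mulC mulmxK.
have [H [sgH fiH trH]] := trace_eq_on_finite_index charF0 m_gt0 eq_pow.
(* Passing to the core keeps the trace equality and provides the normality that [clifford]
   requires. *)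
have [K [sgK fiK sKH nK]] := normal_core sgH fiH.
exists K; split=> //; apply: isomorphic_of_trace => //.
- exact: clifford.
- exact: clifford.
- by move=> h /sKH; apply: trH.
Qed.
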